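(* If a ring $R$ is unit-central, then $R$ is nil-reversible.
   Context: All rings are associative with identity. For a ring $R$, $N(R)$, $U(R)$ and $Z(R)$ denote respectively the set of all nilpotent elements, the group of units, and the set of all central elements of $R$. For $a\in R$, $l(a)=\{x\in R: xa=0\}$ and $r(a)=\{x\in R: ax=0\}$. A ring $R$ is nil-reversible if $l(a)=r(a)$ for every $a\in N(R)$. A ring $R$ is unit-central if $U(R)\subseteq Z(R)$. *)

(* Defs.v *)
From HB Require Import structures.
From mathcomp Require Import all_boot all_order all_algebra.

Set Implicit Arguments.
Unset Strict Implicit.
Unset Printing Implicit Defensive.

Import GRing.Theory.
Local Open Scope ring_scope.

(* Rings are [pzRingType]: associative with identity, possibly zero.  Units are
   defined by existence of a two-sided inverse rather than by [GRing.unit],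
   which would require a [unitRingType], i.e. a nonzero ring together with a
   chosen inverse operation and a boolean unit test. *)

Definition nilpotent_elt (R : pzRingType) (a : R) : Prop :=
  exists n : nat, a ^+ n = 0.

Definition unit_elt (R : pzRingType) (u : R) : Prop :=
  exists v : R, u * v = 1 /\ v * u = 1.

Definition central_elt (R : pzRingType) (z : R) : Prop :=
  forall x : R, GRing.comm z x.

Definition left_ann (R : pzRingType) (a : R) : R -> Prop :=
  fun x => x * a = 0.

Definition right_ann (R : pzRingType) (a : R) : R -> Prop :=
  fun x => a * x = 0.

Definition nil_reversible (R : pzRingType) : Prop :=
  forall a : R, nilpotent_elt a -> forall x : R, left_ann a x <-> right_ann a x.

Definition unit_central (R : pzRingType) : Prop :=
  forall u : R, unit_elt u -> central_elt u.

(* Main.v *)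
Require Import Defs.
From mathcomp Require Import all_boot all_order all_algebra.

(** If [a] is nilpotent then [1 - a] is a unit, its inverse being the geometric
    series in [a], which is a finite sum.  In a unit-central ring [1 - a] is
    therefore central, and so is [a = 1 - (1 - a)].  Nilpotent elements being
    central, their left and right annihilators coincide
    ([one_sub_nilpotent_unit], [nilpotent_central]). *)

Import GRing.Theory.
Local Open Scope ring_scope.

(** The finite geometric sum is a right inverse by the factorisation of
    [a ^+ n - 1], and also a left inverse because it commutes with [a]. *)
Lemma one_sub_nilpotent_unit (R : pzRingType) (a : R) :
  nilpotent_elt a -> unit_elt (1 - a).
Proof.
move=> [n an0]; pose s := \sum_(i < n) a ^+ i.
have inv_r : (1 - a) * s = 1.
  by rewrite -opprB mulNr -subrX1 an0 sub0r opprK.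
have comm_as : GRing.comm a s.
  by apply: commr_sum => i _; apply: commrX.
exists s; split=> //.
by rewrite -[RHS]inv_r mulrBr mulrBl mulr1 mul1r comm_as.
Qed.

Lemma nilpotent_central (R : pzRingType) (a : R) :
  unit_central R -> nilpotent_elt a -> central_elt a.
Proof.
move=> ucR nil_a x.
have comm1a := ucR _ (one_sub_nilpotent_unit _ _ nil_a) x.
apply: commr_sym; rewrite -[a](subKr 1).
by apply: commrB; [apply: commr1 | apply: commr_sym].
Qed.

Theorem proposition2p10 (R : pzRingType) : unit_central R -> nil_reversible R.
Proof.
move=> ucR a nil_a x; rewrite /left_ann /right_ann.
by rewrite (nilpotent_central _ _ ucR nil_a x).
Qed.
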